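(* Let $p$ be a prime and $r\ge 2$ an integer. Let $M$ be the $2r\times 2r$ matrix over $\mathbb{Z}_p$ and $R=R_M$ the $p^r\times p^r$ array determined by $M$, both defined in the context. Then $R$ is a linear type-$p$ most-perfect square of order $p^r$.
   Context: **Squares.** Rows and columns of a square array of order $n$ are indexed by $0,1,\dots,n-1$ (rows from top to bottom, columns from left to right); with wraparound, indices are read modulo $n$. A square $R=(R_{i,j})$ of order $n$ is natural if each of the integers $0,1,\dots,n^2-1$ occurs exactly once as an entry. It is a pandiagonal magic square if the entries of each row, each column, each broken main diagonal $\{(i+k,j+k): 0\le k<n\}$ and each broken off-diagonal $\{(i-k,j+k):0\le k<n\}$ (indices mod $n$) have the same sum; for a natural square this magic sum is $n(n^2-1)/2$. Let $n$ be a positive integer divisible by $p$. A natural pandiagonal magic square $R$ of order $n$ is a most-perfect square of type $p$ (type-$p$ most-perfect square) if: (i) (Complementary property) for every location $(i,j)$, $\sum_{k=0}^{p-1} R_{i+kn/p,\;j+kn/p}=\frac{p(n^2-1)}{2}$ (indices mod $n$); (ii) ($p\times p$ property) every $p\times p$ subsquare formed from consecutive rows and columns, allowing wraparound, has entries summing to $\frac{p^2(n^2-1)}{2}$. **Linear squares.** Here $\mathbb{Z}_p$ is the field with $p$ elements, with $\{0,1,\dots,p-1\}$ as representatives. An integer $\Lambda\in\{0,1,\dots,p^{2r}-1\}$ with base-$p$ expansion $\Lambda=\sum_{k=1}^{2r}\lambda_k p^{2r-k}$, $0\le\lambda_k\le p-1$, is identified with the column vector $(\lambda_1,\dots,\lambda_{2r})\in\mathbb{Z}_p^{2r}$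 (most significant digit first). A location (row $a$, column $b$) in a $p^r\times p^r$ array, $0\le a,b<p^r$, is identified with the vector in $\mathbb{Z}_p^{2r}$ whose first $r$ entries are the base-$p$ digits of $a$ (most significant first) and whose last $r$ entries are the base-$p$ digits of $b$ (most significant first). A $2r\times 2r$ matrix $M$ over $\mathbb{Z}_p$ determines an array $R_M$ by declaring that each symbol $\Lambda\in\{0,\dots,p^{2r}-1\}$ is placed in location $M\Lambda$. A magic square that can be represented as $R_M$ for some such $M$ is called linear. **The matrix $M$.** Let $L_r=(\ell_{ij})$ be the $r\times r$ matrix with $\ell_{ij}=1$ if $i+j>r$ and $\ell_{ij}=0$ if $i+j\le r$. Let $L=\begin{pmatrix}0&L_r\\ L_r&0\end{pmatrix}$, a $2r\times 2r$ matrix over $\mathbb{Z}_p$ with columns $\ell_1,\dots,\ell_{2r}$. Let $e_1,\dots,e_{2r}$ be the standard basis of $\mathbb{Z}_p^{2r}$ and put $\tilde\ell_j=\ell_j-(e_1+e_{r+1})$ for $1\le j\le 2r$. Then $M$ is the $2r\times 2r$ matrix over $\mathbb{Z}_p$ with columns $m_1,\dots,m_{2r}$ given by $m_j=\tilde\ell_j$ for $1\le j<r$ and for $r<j<2r$, $m_r=\tilde\ell_r+\sum_{j=2}^{r-1}(-1)^{j+1}\tilde\ell_{r-j}$, and $m_{2r}=\tilde\ell_{2r}+\sum_{j=2}^{r-1}(-1)^{j+1}\tilde\ell_{2r-j}$ (empty sums are $0$ when $r=2$). *)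

(* Defs.v *)
From mathcomp Require Import all_boot all_order all_algebra.

Set Implicit Arguments.
Unset Strict Implicit.
Unset Printing Implicit Defensive.

Import GRing.Theory.

(* Wraparound indexing: the index i + k read modulo n. *)
Definition shift n (i : 'I_n) (k : nat) : 'I_n :=
  Ordinal (ltn_pmod (i + k) (leq_ltn_trans (leq0n i) (ltn_ord i))).

Section Squares.

Variable n : nat.
Implicit Type R : 'M[nat]_n.

Definition natural_square R : Prop :=
  forall v : nat, v < n ^ 2 -> #|[set ij : 'I_n * 'I_n | R ij.1 ij.2 == v]| = 1.

Definition magic_square R : Prop :=
  exists s : nat,
    [/\ forall i : 'I_n, \sum_(j < n) R i j = s,
        forall j : 'I_n, \sum_(i < n) R i j = s,
        \sum_(k < n) R k k = s
      & \sum_(k < n) R (rev_ord k) k = s].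

(* For k < n, shifting by n - k is subtracting k modulo n. *)
Definition pandiagonal_magic_square R : Prop :=
  exists s : nat,
    [/\ forall i : 'I_n, \sum_(j < n) R i j = s,
        forall j : 'I_n, \sum_(i < n) R i j = s,
        forall i j : 'I_n, \sum_(k < n) R (shift i k) (shift j k) = s
      & forall i j : 'I_n, \sum_(k < n) R (shift i (n - k)) (shift j k) = s].

(* The prescribed sums p (n^2 - 1) / 2 and p^2 (n^2 - 1) / 2 are rational
   numbers; both sides are multiplied by 2 to avoid truncated division. *)
Definition complementary (p : nat) R : Prop :=
  forall i j : 'I_n,
    2 * (\sum_(k < p) R (shift i (k * (n %/ p))) (shift j (k * (n %/ p))))
    = p * (n ^ 2 - 1).

Definition subsquare_property (p : nat) R : Prop :=
  forall i j : 'I_n,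
    2 * (\sum_(k < p) \sum_(l < p) R (shift i k) (shift j l))
    = p ^ 2 * (n ^ 2 - 1).

Definition most_perfect (p : nat) R : Prop :=
  [/\ 0 < n /\ p %| n,
      natural_square R,
      pandiagonal_magic_square R,
      complementary p R
    & subsquare_property p R].

End Squares.

Local Open Scope ring_scope.

(* The m base-p digits of x, most significant first. *)
Definition digits (p m x : nat) : 'cV['F_p]_m :=
  \col_(k < m) ((x %/ p ^ (m - k.+1)) %% p)%N%:R.

Definition location (p r a b : nat) : 'cV['F_p]_(r + r) :=
  col_mx (digits p r a) (digits p r b).

(* R is the array R_M: every symbol x stands in location M x.  If M is singular
   then two symbols compete for one location and no R qualifies. *)
Definition array_of (p r : nat) (M : 'M['F_p]_(r + r))
    (R : 'M[nat]_(p ^ r)) : Prop :=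
  forall (x : nat) (a b : 'I_(p ^ r)), (x < p ^ (2 * r))%N ->
    M *m digits p (r + r) x = location p r a b -> R a b = x.

Definition linear_square (p r : nat) (R : 'M[nat]_(p ^ r)) : Prop :=
  magic_square R /\ exists M : 'M['F_p]_(r + r), array_of M R.

Section TheMatrix.

Variables p r : nat.

(* In this section rows and columns are numbered from 1, as in the formulas for
   M; the ordinal i carries the number i.+1. *)

Definition Lr : 'M['F_p]_r := \matrix_(i, j) (r < i.+1 + j.+1)%N%:R.

Definition L : 'M['F_p]_(r + r) := block_mx 0 Lr Lr 0.

Definition ell (j : nat) : 'cV['F_p]_(r + r) :=
  \sum_(k < r + r | k.+1 == j) col k L.

Definition std_basis (i : nat) : 'cV['F_p]_(r + r) :=
  \col_(k < r + r) (k.+1 == i)%:R.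

Definition ell_tilde (j : nat) : 'cV['F_p]_(r + r) :=
  ell j - (std_basis 1 + std_basis r.+1).

Definition mcol (j : nat) : 'cV['F_p]_(r + r) :=
  if (j == r) || (j == 2 * r)%N then
    ell_tilde j + \sum_(2 <= k < r) (-1) ^+ k.+1 *: ell_tilde (j - k)
  else ell_tilde j.

Definition matM : 'M['F_p]_(r + r) := \matrix_(i, j) mcol j.+1 i 0.

End TheMatrix.

(* Main.v *)
Require Import Defs.
From mathcomp Require Import all_boot all_order all_algebra all_fingroup.
From mathcomp Require Import zify.

Set Implicit Arguments.
Unset Strict Implicit.
Unset Printing Implicit Defensive.

Import GRing.Theory.

(** Put n = p ^ r.  Write a location as a pair (u, v) of digit vectors, row
digits first, and a symbol as (x, y), and let e be the first basis vector of
length r.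

The columns of M carry the columns of Lr, shifted by -(e, e), and the changes
made to columns r and 2r amount to multiplying on the right by a unipotent
matrix C in each half.  With U = Lr C this reads

  M (x, y) = (U y - s e, U x - s e),   s = last entry of U x + U y,

because the last row of Lr sums all entries ([matM_mul]).  The matrix U is
invertible and r >= 2 makes the last entry of e vanish, so s is the sum of the
last digits of u and v and M is inverted explicitly: the symbol at (u, v) is
(G (v + s e), G (u + s e)) with G = U^-1 ([matM_symbol], [symbol_matM]).

The purpose of C is that U maps the alternating vector (.., 1, -1, 1) to e
([Ur_alternating]), so that every entry of G e is 1 or -1, hence nonzero.
Consequently every digit of the symbol runs through an arithmetic progression of
nonzero difference, and so takes each value in F_p once, in either of the
following situations, stated for x and symmetric for y:
- at step k, u has moved by a multiple of e and v by k b e with b nonzero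
  ([balanced_half_symbol_top]); steps of n / p, which change top digits only, do
  this along a row for x, along a column for y, and along a broken diagonal for
  both;
- v is fixed and the last digit of u runs through F_p, whatever the other digits
  do ([balanced_half_symbol_last]); p consecutive rows do this, which absorbs all
  carries.

A family of locations on which each digit has the same total as if it were
uniform has the required sum of symbols ([undigits_balanced]).  The complementary
property is an instance of the first situation, and the p x p property of the
second one, taken row by row for y and column by column for x.  Rows, columns and
broken diagonals follow by averaging over shifts along the line
([balanced_average]). *)

(** * Digits that are uniform on average *)

Section Balanced.

Variable p : nat.
Hypothesis p_prime : prime p.

(** The mean of f, with values read in 0, .., p - 1, is (p - 1) / 2. *)
Definition balanced (T : finType) (f : T -> 'F_p) : Prop :=
  2 * (\sum_x (f x : nat)) = #|T| * (p - 1).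

Lemma Fp_natr_val k : k < p -> (k%:R%R : 'F_p) = k :> nat.
Proof. by move=> ltkp; rewrite val_Fp_nat // modn_small. Qed.

Lemma balanced_progression (f : 'I_p -> 'F_p) (c d : 'F_p) :
  d != 0%R -> (forall k : 'I_p, f k = (c + k%:R * d)%R) -> balanced f.
Proof.
move=> dn0 fE; rewrite /balanced card_ord.
have bij_of (g : 'I_p -> 'F_p) : injective g -> bijective g.
  by move=> injg; apply: inj_card_bij => //; rewrite card_Fp ?card_ord.
have injnat : injective (fun k : 'I_p => k%:R%R : 'F_p).
  by move=> k l /(congr1 val) /=; rewrite !Fp_natr_val // => /val_inj.
have injf : injective f.
  by move=> k l; rewrite !fE => /addrI /(mulIf dn0) /injnat.
have sumE (g : 'I_p -> 'F_p) : bijective g ->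
    \sum_(k < p) (g k : nat) = \sum_(z : 'F_p) (z : nat).
  by move=> bijg; rewrite [RHS](reindex g) //; apply: onW_bij.
have -> : \sum_(k < p) (f k : nat) = \sum_(0 <= k < p) k.
  rewrite (sumE f (bij_of _ injf)).
  rewrite -(sumE (fun k : 'I_p => k%:R%R) (bij_of _ injnat)) big_mkord.
  by apply: eq_bigr => k _; rewrite Fp_natr_val.
rewrite bin2_sum mul2n bin2 subn1 -[RHS](odd_double_half (p * p.-1)).
by rewrite -subn1 oddM oddB ?prime_gt0 //= addbT andbN.
Qed.

(** If every x lies in a balanced p-term family f (tau k x), then f is balanced:
summing these families over x counts each value of f exactly p times. *)
Lemma balanced_average (T : finType) (f : T -> 'F_p) (tau : 'I_p -> T -> T) :
    (forall k, injective (tau k)) ->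
    (forall x, balanced (fun k => f (tau k x))) ->
  balanced f.
Proof.
move=> tau_inj bal; rewrite /balanced; apply/eqP.
rewrite -(eqn_pmul2l (prime_gt0 p_prime)) mulnCA; apply/eqP.
have -> : p * (\sum_x (f x : nat)) = \sum_x \sum_(k < p) (f (tau k x) : nat).
  rewrite exchange_big /= -{1}[p]card_ord -sum_nat_const; apply: eq_bigr => k _.
  by rewrite (reindex_inj (tau_inj k)).
rewrite big_distrr /= (eq_bigr (fun=> p * (p - 1))).
  by rewrite sum_nat_const mulnCA.
by move=> x _; have := bal x; rewrite /balanced card_ord.
Qed.

Lemma balanced_fibers (T T' : finType) (f : T * T' -> 'F_p) :
  (forall x, balanced (fun y => f (x, y))) -> balanced f.
Proof.
move=> bal; rewrite /balanced.
rewrite (eq_bigr (fun z => f (z.1, z.2) : nat)) => [|[] //].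
rewrite -(pair_bigA _ (fun x y => f (x, y) : nat)) /=.
rewrite big_distrr /= (eq_bigr (fun=> #|T'| * (p - 1))) => [|x _]; last exact: bal.
by rewrite sum_nat_const card_prod mulnA.
Qed.

Lemma balanced_reindex (T T' : finType) (h : T -> T') (f : T' -> 'F_p) :
  bijective h -> balanced (f \o h) -> balanced f.
Proof.
move=> bijh; rewrite /balanced (bij_eq_card bijh) => <-; congr (2 * _).
by rewrite (reindex h) //; apply: onW_bij.
Qed.

End Balanced.

(** * Base-p digits *)

Section Digits.

Variable p : nat.
Hypothesis p_prime : prime p.

Definition undigits m (w : 'cV['F_p]_m) : nat :=
  \sum_(k < m) (w k 0%R : nat) * p ^ (m - k.+1).

Lemma base_expansion m x :
  \sum_(k < m) (x %/ p ^ k) %% p * p ^ k = x %% p ^ m.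
Proof.
elim: m => [|m IHm]; first by rewrite big_ord0 expn0 modn1.
rewrite big_ord_recr /= IHm modn_divl -expnS addnC.
by rewrite -[x %% p ^ m](@modn_dvdm (p ^ m.+1)) ?dvdn_exp2l // -divn_eq.
Qed.

Lemma undigits_digits m x : x < p ^ m -> undigits (digits p m x) = x.
Proof.
move=> ltx; rewrite -[RHS](modn_small ltx) -base_expansion.
rewrite (reindex_inj rev_ord_inj); apply: eq_bigr => k _.
by rewrite mxE val_Fp_nat // modn_mod.
Qed.

Lemma digits_surj m (w : 'cV['F_p]_m) : exists2 x, x < p ^ m & digits p m x = w.
Proof.
pose f (x : 'I_(p ^ m)) := digits p m x.
have injf : injective f.
  by move=> x y /(congr1 (@undigits m)); rewrite !undigits_digits // => /val_inj.
have [|g _ gK] := inj_card_bij injf.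
  by rewrite card_mx card_Fp // card_ord muln1.
by exists (g w); rewrite ?ltn_ord //; apply: gK.
Qed.

Lemma undigitsK m (w : 'cV['F_p]_m) : digits p m (undigits w) = w.
Proof. by have [x ltx <-] := digits_surj w; rewrite undigits_digits. Qed.

Lemma undigits_lt m (w : 'cV['F_p]_m) : undigits w < p ^ m.
Proof. by have [x ltx <-] := digits_surj w; rewrite undigits_digits. Qed.

Lemma digits_modn m x : digits p m (x %% p ^ m) = digits p m x.
Proof.
apply/colP => k; rewrite !mxE !modn_divl -expnS modn_dvdm //.
by rewrite dvdn_exp2l // -subSn // subSS leq_subr.
Qed.

Lemma digits_ord_max m x : digits p m.+1 x ord_max 0%R = (x%:R)%R.
Proof. by rewrite mxE subnn divn1 Fp_nat_mod. Qed.

(** Adding k times the weight of the leading digit produces no carry that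
survives reduction modulo p ^ m.+1. *)
Lemma digits_top m x k :
  digits p m.+1 (x + k * p ^ m) = (digits p m.+1 x + k%:R *: delta_mx ord0 0)%R.
Proof.
apply/colP => i; rewrite !mxE eqxx andbT !Fp_nat_mod // subSS.
have [->|i_gt0] := eqVneq i ord0.
  by rewrite subn0 addnC divnMDl ?expn_gt0 ?prime_gt0 // natrD mulr1 addrC.
rewrite mulr0 addr0; have lti : i <= m by rewrite -ltnS.
have {}i_gt0 : 0 < i by rewrite lt0n.
have -> : k * p ^ m = k * p ^ i.-1 * p * p ^ (m - i).
  by rewrite -!mulnA -expnS -expnD addnS -addSn prednK // subnKC.
rewrite addnC divnMDl ?expn_gt0 ?prime_gt0 // natrD -[in LHS]Fp_nat_mod //.
by rewrite modnMl add0r.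
Qed.

(** The symbols are treated digit by digit: the weights p ^ i times p - 1 add up
to p ^ m - 1. *)
Lemma undigits_balanced m (T : finType) (w : T -> 'cV['F_p]_m) :
    (forall i, balanced (fun x => w x i 0%R)) ->
  2 * (\sum_x undigits (w x)) = #|T| * (p ^ m - 1).
Proof.
move=> bal; rewrite exchange_big /= big_distrr /=.
rewrite (eq_bigr (fun i : 'I_m => #|T| * (p - 1) * p ^ (m - i.+1))); last first.
  by move=> i _; rewrite -big_distrl mulnA /= (bal i).
rewrite -big_distrr /= -mulnA (reindex_inj rev_ord_inj) /=.
rewrite (eq_bigr (fun i : 'I_m => p ^ i)) => [|i _].
  by congr (_ * _); rewrite !subn1 [RHS]predn_exp.
by rewrite subnSK // subKn // ltnW.
Qed.

End Digits.

(** * The matrix M and its inverse *)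

Section LinearAlgebra.

Local Open Scope ring_scope.

Variables p q : nat.
Hypothesis p_prime : prime p.

Local Notation r := q.+2.

Definition e1 : 'cV['F_p]_r := delta_mx ord0 0.

(** The multiples of the earlier columns that are added to column r. *)
Definition correction : 'cV['F_p]_r :=
  \col_i \sum_(2 <= k < r) (-1) ^+ k.+1 * (i.+1 == r - k)%N%:R.

Local Notation last_row := (delta_mx 0 ord_max : 'rV['F_p]_r).

Definition Cr : 'M['F_p]_r := 1%:M + correction *m last_row.

Definition Ur : 'M['F_p]_r := Lr p r *m Cr.

Definition alternating : 'cV['F_p]_r := \col_i (-1) ^+ (r - i.+1).

Lemma CrE i j : Cr i j = (i == j)%:R + correction i 0 * (j == ord_max)%:R.
Proof.
by rewrite [LHS]mxE [X in X + _]mxE [X in _ + X]mxE big_ord1 [X in _ * X]mxE.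
Qed.

Lemma correctionE i :
  correction i 0 = if (i.+2 < r)%N then (-1) ^+ (r - i) else 0.
Proof.
rewrite mxE; case: ifP => [lti|/negbT gei].
  rewrite (bigD1_seq (r - i.+1)%N) ?mem_index_iota ?iota_uniq //=; last lia.
  rewrite big1_seq ?addr0 => [|k /andP[kn]].
    rewrite subKn ?eqxx ?mulr1; last lia.
    by rewrite subnSK //; lia.
  rewrite mem_index_iota => kr.
  have -> : (i.+1 == r - k)%N = false by lia.
  by rewrite mulr0.
rewrite big1_seq // => k /andP[_]; rewrite mem_index_iota => kr.
have -> : (i.+1 == r - k)%N = false by lia.
by rewrite mulr0.
Qed.

(** Reversing the columns of Lr gives a lower triangular matrix with ones on the
diagonal. *)
Lemma Lr_unit : Lr p r \in unitmx.
Proof.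
have : \det (col_perm (perm rev_ord_inj) (Lr p r)) = 1.
  rewrite det_trig; last first.
    apply/is_trig_mxP => i j lt_ij; rewrite !mxE permE /=.
    have ltj := ltn_ord j.
    by have -> : (r < i.+1 + (r - j.+1).+1)%N = false by lia.
  apply: big1 => i _; rewrite !mxE permE /=.
  have lti := ltn_ord i.
  by have -> : (r < i.+1 + (r - i.+1).+1)%N by lia.
rewrite col_permE det_mulmx unitmxE => /esym unitE.
by move: (unitr1 'F_p); rewrite unitE unitrM => /andP[].
Qed.

(** The rank one part of Cr squares to zero, because the last entry of the
correction is zero. *)
Lemma Cr_unit : Cr \in unitmx.
Proof.
suff /mulmx1_unit[] : Cr *m (1%:M - correction *m last_row) = 1%:M by [].
rewrite /Cr mulmxDl mul1mx mulmxBr mulmx1.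
have -> : correction *m last_row *m (correction *m last_row) = 0.
  rewrite mulmxA -[_ *m _ *m correction]mulmxA.
  have -> : last_row *m correction = 0 :> 'M_1.
    apply/matrixP => i j; rewrite !ord1 -rowE [LHS]mxE correctionE /=.
    by rewrite ltnNge leqnSn mxE.
  by rewrite mulmx0 mul0mx.
by rewrite subr0 subrK.
Qed.

Lemma Ur_unit : Ur \in unitmx.
Proof. by rewrite unitmx_mul Lr_unit Cr_unit. Qed.

(** The correction cancels the alternating vector except in its last two
entries. *)
Lemma Cr_alternating :
  Cr *m alternating = delta_mx ord_max 0 - delta_mx (inord q) 0.
Proof.
apply/colP => i; rewrite mulmxDl mul1mx -mulmxA.
have -> : last_row *m alternating = 1%:M.
  by apply/matrixP => k l; rewrite !ord1 -rowE !mxE subnn.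
rewrite mulmx1 [LHS]mxE correctionE !mxE !andbT -!val_eqE /= inordK //.
have lti := ltn_ord i.
have [lti'|] := ltnP i.+2 r.
  have -> : (r - i = (r - i.+1).+1)%N by lia.
  rewrite exprS mulN1r addrN.
  have -> : (i == q.+1 :> nat) = false by lia.
  have -> : (i == q :> nat) = false by lia.
  by rewrite subr0.
rewrite ltnS addr0 => gei.
have [->|->] : i = q :> nat \/ i = q.+1 :> nat by lia.
- by rewrite eqxx subSnn expr1 ltn_eqF // sub0r.
- by rewrite eqxx subnn expr0 gtn_eqF // subr0.
Qed.

(** This identity is what the correction of columns r and 2r is for: it makes all
entries of the first column of the inverse of Ur equal to 1 or -1. *)
Lemma Ur_alternating : Ur *m alternating = e1.
Proof.
rewrite -mulmxA Cr_alternating mulmxBr -!colE.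
apply/colP => i; rewrite !mxE andbT inordK // -val_eqE /=.
have -> : (r < i.+1 + r)%N by lia.
have -> : (r < i.+1 + q.+1)%N = (i != 0 :> nat) by lia.
by case: eqP; rewrite ?subr0 ?subrr.
Qed.

Lemma Lr_last (z : 'cV['F_p]_r) : (Lr p r *m z) ord_max 0 = \sum_i z i 0.
Proof.
rewrite mxE; apply: eq_bigr => i _.
by rewrite mxE /= -addSnnS ltnS leq_addr mul1r.
Qed.

Lemma ell_tildeE (j : 'I_(r + r)) :
  ell_tilde p r j.+1 = L p r *m delta_mx j 0 - col_mx e1 e1.
Proof.
rewrite /ell_tilde /ell (big_pred1 j) ?colE => [|k]; last exact: eqSS.
congr (_ - _); apply/colP => k; rewrite -(splitK k).
case: (split k) => i /=; rewrite ?(col_mxEu, col_mxEd) !mxE /= andbT -val_eqE.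
  have lti := ltn_ord i.
  have -> : (i.+1 == r.+1)%N = false by lia.
  by rewrite eqSS addr0.
rewrite eqSS; have -> : (r + i == r)%N = (i == 0%N :> nat) by lia.
by rewrite add0r.
Qed.

Definition ell_tilde_mx : 'M['F_p]_(r + r) := L p r - col_mx e1 e1 *m const_mx 1.

(** Stated for the basis vectors, so that the combinations of tilde columns that
define columns r and 2r of M become combinations of basis vectors. *)
Lemma ell_tilde_basis j :
  (0 < j <= r + r)%N -> ell_tilde p r j = ell_tilde_mx *m std_basis p r j.
Proof.
case: j => // j /= ltj; rewrite (ell_tildeE (Ordinal ltj)) /ell_tilde_mx mulmxBl.
have -> : std_basis p r j.+1 = delta_mx (Ordinal ltj) 0.
  by apply/colP => k; rewrite !mxE andbT -val_eqE eqSS.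
congr (_ - _); rewrite -mulmxA.
have -> : const_mx 1 *m delta_mx (Ordinal ltj) 0 = 1%:M :> 'M['F_p]_1.
  by rewrite -colE; apply/matrixP => k l; rewrite !ord1 !mxE.
by rewrite mulmx1.
Qed.

Lemma matM_factor : matM p r = ell_tilde_mx *m block_mx Cr 0 0 Cr.
Proof.
apply/matrixP => i j; rewrite [LHS]mxE.
suff -> : mcol p r j.+1 = ell_tilde_mx *m col j (block_mx Cr 0 0 Cr).
  by rewrite mxE [RHS]mxE; apply: eq_bigr => k _; rewrite [col _ _ _ _]mxE.
pose t := if (j.+1 == r) || (j.+1 == 2 * r)%N then
  \sum_(2 <= k < r) (-1) ^+ k.+1 *: std_basis p r (j.+1 - k) else 0.
have -> : mcol p r j.+1 = ell_tilde_mx *m (std_basis p r j.+1 + t).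
  rewrite mulmxDr /t /mcol -ell_tilde_basis ?ltn_ord //.
  case: ifP => [jE|_]; last by rewrite mulmx0 addr0.
  congr (_ + _); rewrite mulmx_sumr; apply: eq_big_nat => k kr.
  by rewrite -scalemxAr ell_tilde_basis //; have := ltn_ord j; lia.
congr (_ *m _); apply/colP => k; rewrite [LHS]mxE [in RHS]mxE [X in X + _]mxE.
have -> : t k 0 = if (j.+1 == r) || (j.+1 == 2 * r)%N then
    \sum_(2 <= l < r) (-1) ^+ l.+1 * (k.+1 == j.+1 - l)%N%:R else 0.
  rewrite /t; case: ifP => _; last by rewrite mxE.
  by rewrite summxE; apply: eq_bigr => l _; rewrite !mxE.
(* In the two off-diagonal blocks the correction of a column never reaches the
   other half: its terms have indices j - k with 2 <= k < r. *)
rewrite eqSS {t}; rewrite -(splitK k) -(splitK j).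
case: (split k) => a; case: (split j) => b /=;
  have ltb := ltn_ord b; have lta := ltn_ord a.
- rewrite block_mxEul CrE mxE -!val_eqE /=.
  have -> : (b.+1 == 2 * r)%N = false by lia.
  rewrite orbF eqSS; congr (_ + _).
  by case: ((b : nat) =P q.+1) => [->|_]; rewrite ?mulr1 ?mulr0.
- rewrite block_mxEur mxE; have -> : (a == r + b :> nat)%N = false by lia.
  rewrite add0r; case: ifP => // bE; apply: big1_seq => l /andP[_].
  rewrite mem_index_iota => lr.
  have -> : (a.+1 == (r + b).+1 - l)%N = false by lia.
  by rewrite mulr0.
- rewrite block_mxEdl mxE; have -> : (r + a == b :> nat)%N = false by lia.
  rewrite add0r; case: ifP => // bE; apply: big1_seq => l /andP[_].
  rewrite mem_index_iota => lr.
  have -> : ((r + a).+1 == b.+1 - l)%N = false by lia.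
  by rewrite mulr0.
- rewrite block_mxEdr CrE mxE -!val_eqE /= eqn_add2l.
  have -> : ((r + b).+1 == r)%N = false by lia.
  have -> : ((r + b).+1 == 2 * r)%N = (b == q.+1 :> nat) by lia.
  congr (_ + _); case: ((b : nat) =P q.+1) => [bE|_]; last by rewrite mulr0.
  rewrite mulr1; apply: eq_big_nat => l lr.
  by congr (_ * _%:R); congr nat_of_bool; lia.
Qed.

Lemma matM_mul (x y : 'cV['F_p]_r) (s := (Ur *m x + Ur *m y) ord_max 0) :
  matM p r *m col_mx x y = col_mx (Ur *m y - s *: e1) (Ur *m x - s *: e1).
Proof.
rewrite matM_factor -mulmxA mul_block_col !mul0mx addr0 add0r mulmxBl.
rewrite mul_block_col !mul0mx addr0 add0r -mulmxA.
(* The last row of Lr is constant 1, so the last entry of Ur *m x is the sum of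
   the entries of Cr *m x. *)
have -> : const_mx 1 *m col_mx (Cr *m x) (Cr *m y) = s%:M :> 'M['F_p]_1.
  apply/matrixP => k l; rewrite !ord1 [RHS]mxE eqxx mulr1n /s /Ur -!mulmxA.
  rewrite [RHS]mxE !Lr_last mxE big_split_ord /=; congr (_ + _);
    by apply: eq_bigr => i _; rewrite mxE mul1r ?col_mxEu ?col_mxEd.
by rewrite mul_mx_scalar scale_col_mx opp_col_mx add_col_mx !mulmxA.
Qed.

(** The first half of the inverse image of (u, v) under M: as e1 has last entry 0,
the scalar subtracted by M is the sum of the last entries of u and v.  The second
half is obtained by exchanging u and v. *)
Definition half_symbol (u v : 'cV['F_p]_r) : 'cV['F_p]_r :=
  invmx Ur *m (v + (u ord_max 0 + v ord_max 0) *: e1).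

Definition symbol (u v : 'cV['F_p]_r) : 'cV['F_p]_(r + r) :=
  col_mx (half_symbol u v) (half_symbol v u).

Lemma matM_symbol u v : matM p r *m symbol u v = col_mx u v.
Proof.
rewrite matM_mul /half_symbol !mulKVmx ?Ur_unit //.
set s := u ord_max 0 + v ord_max 0.
have -> : v ord_max 0 + u ord_max 0 = s by rewrite addrC.
have -> : (v + s *: e1 + (u + s *: e1)) ord_max 0 = s.
  by rewrite !mxE /= !mulr0 !addr0 addrC.
by rewrite !addrK.
Qed.

(** A right inverse of a self-map of a finite set is also a left inverse. *)
Lemma symbol_matM (w : 'cV['F_p]_(r + r)) u v :
  matM p r *m w = col_mx u v -> symbol u v = w.
Proof.
have cK : cancel (fun w => symbol (usubmx w) (dsubmx w)) (mulmx (matM p r)).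
  by move=> z; rewrite matM_symbol vsubmxK.
by move=> Mw; have := canF_sym cK w; rewrite Mw col_mxKu col_mxKd.
Qed.

(** Separates the dependence on the last digits: their sum enters every digit of
the half symbol with coefficient 1 or -1. *)
Lemma half_symbolE u v i :
  half_symbol u v i 0
  = (invmx Ur *m v) i 0 + (u ord_max 0 + v ord_max 0) * alternating i 0.
Proof.
rewrite /half_symbol mulmxDr -scalemxAr -Ur_alternating mulKmx ?Ur_unit //.
by rewrite [LHS]mxE [X in _ + X]mxE.
Qed.

Lemma alternating_neq0 i : alternating i 0 != 0.
Proof. by rewrite mxE signr_eq0. Qed.

(** Multiples of e1 do not affect the last digits, so only the term in v changes,
along the inverse image of e1, which is the alternating vector. *)
Lemma balanced_half_symbol_top (u v : 'I_p -> 'cV['F_p]_r) u0 v0 a b i :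
    b != 0 ->
    (forall k, u k = u0 + (k%:R * a) *: e1) ->
    (forall k, v k = v0 + (k%:R * b) *: e1) ->
  balanced (fun k => half_symbol (u k) (v k) i 0).
Proof.
move=> b0 uE vE.
have e1_last c : (c *: e1) ord_max 0 = 0 by rewrite !mxE /= mulr0.
apply: (@balanced_progression p p_prime _
          ((invmx Ur *m v0) i 0 + (u0 ord_max 0 + v0 ord_max 0) * alternating i 0)
          (b * alternating i 0)).
  by rewrite mulf_neq0 ?alternating_neq0.
move=> k; rewrite half_symbolE uE vE mulmxDr -scalemxAr.
rewrite [(u0 + _) _ _]mxE [(v0 + _) _ _]mxE !e1_last !addr0.
rewrite -Ur_alternating mulKmx ?Ur_unit //.
by rewrite [X in X + _]mxE [X in _ + X + _]mxE mulrA addrAC.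
Qed.

Lemma balanced_half_symbol_last (u : 'I_p -> 'cV['F_p]_r) u0 v i :
    (forall k, u k ord_max 0 = u0 + k%:R) ->
  balanced (fun k => half_symbol (u k) v i 0).
Proof.
move=> uE.
apply: (@balanced_progression p p_prime _
          ((invmx Ur *m v) i 0 + (u0 + v ord_max 0) * alternating i 0)
          (alternating i 0)); first exact: alternating_neq0.
by move=> k; rewrite half_symbolE uE addrAC mulrDl addrA.
Qed.

End LinearAlgebra.

(** * The square and its sums *)

Section Square.

Variables p q : nat.
Hypothesis p_prime : prime p.

Local Notation r := q.+2.
Local Notation n := (p ^ r).
Local Notation D := (digits p r).

Definition square : 'M[nat]_(p ^ q.+2) :=
  (\matrix_(a, b) undigits (symbol (D a) (D b)))%R.

Lemma array_of_square : array_of (matM p r) square.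
Proof.
move=> x a b ltx Mx; rewrite mxE (symbol_matM p_prime Mx) undigits_digits //.
by rewrite addnn -mul2n.
Qed.

Lemma array_of_unique R : array_of (matM p r) R -> square = R.
Proof.
move=> RM; apply/matrixP => a b; apply/esym/RM.
  by rewrite mxE mul2n -addnn undigits_lt.
by rewrite mxE undigitsK // matM_symbol.
Qed.

Lemma digits_shift_top (i : 'I_n) k :
  D (shift i (k * p ^ q.+1)) = (D i + k%:R *: e1 p q)%R.
Proof. by rewrite /shift /= digits_modn // digits_top. Qed.

Lemma digits_shift_last (i : 'I_n) k :
  D (shift i k) ord_max 0%R = ((i : nat)%:R + k%:R)%R.
Proof. by rewrite /shift /= digits_modn // digits_ord_max // natrD. Qed.

Lemma digits_shift_shift_top (i j : 'I_n) k :
  D (shift i (shift j (k * p ^ q.+1))) = (D (shift i j) + k%:R *: e1 p q)%R.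
Proof.
by rewrite -digits_shift_top; congr (D _); rewrite /= modnDmr modnDml addnA.
Qed.

(** Moving forward on an off-diagonal lowers the row, also when the parameter j
wraps around. *)
Lemma digits_opp_shift_top (i j : 'I_n) k :
  D (shift i (n - shift j (k * p ^ q.+1)))
  = (D (shift i (n - j)) + (- k%:R) *: e1 p q)%R.
Proof.
apply/eqP; rewrite scaleNr eq_sym subr_eq -digits_top //; apply/eqP.
rewrite -[RHS]digits_modn // /shift /= modnDml.
set s := j + k * p ^ q.+1.
have -> : i + (n - s %% n) + k * p ^ q.+1 = s %/ n * n + (i + (n - j)).
  have := divn_eq s n; have := ltn_pmod s (leq_ltn_trans (leq0n j) (ltn_ord j)).
  by have := ltn_ord j; rewrite /s; lia.
by rewrite modnMDl.
Qed.

Lemma shift_inj k : injective (fun i : 'I_n => shift i k).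
Proof.
move=> i j /(congr1 val) /= /eqP; rewrite eqn_modDr !modn_small // => /eqP.
exact: val_inj.
Qed.

Lemma sum_square (T : finType) (f g : T -> 'I_n) :
    (forall i, balanced (fun x => half_symbol (D (f x)) (D (g x)) i 0%R)) ->
    (forall i, balanced (fun x => half_symbol (D (g x)) (D (f x)) i 0%R)) ->
  2 * (\sum_x square (f x) (g x)) = #|T| * (n ^ 2 - 1).
Proof.
move=> balf balg.
rewrite -expnM muln2 -addnn.
rewrite -(undigits_balanced (w := fun x => symbol (D (f x)) (D (g x)))).
  by congr (_ * _); apply: eq_bigr => x _; rewrite mxE.
move=> i; rewrite -(splitK i); case: (split i) => j /=.
  have := balf j; rewrite /balanced => <-; congr (_ * _).
  by apply: eq_bigr => x _; rewrite col_mxEu.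
have := balg j; rewrite /balanced => <-; congr (_ * _).
by apply: eq_bigr => x _; rewrite col_mxEd.
Qed.

Lemma balanced_line (a b : 'F_p) (f g : 'I_n -> 'I_n) i :
    b != 0%R ->
    (forall x k, D (f (shift x (k * p ^ q.+1)))
                 = D (f x) + (k%:R * a) *: e1 p q)%R ->
    (forall x k, D (g (shift x (k * p ^ q.+1)))
                 = D (g x) + (k%:R * b) *: e1 p q)%R ->
  balanced (fun x => half_symbol (D (f x)) (D (g x)) i 0%R).
Proof.
move=> b0 fE gE.
apply: (balanced_average p_prime (tau := fun k x => shift x (k * p ^ q.+1))).
  by move=> k; apply: shift_inj.
by move=> x; apply: (balanced_half_symbol_top p_prime _ b0 (fE x) (gE x)).
Qed.

(** Only the last digit of the row number matters here, and it takes all values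
on p consecutive rows, with or without wraparound. *)
Lemma balanced_consecutive (i : 'I_n) v j :
  balanced (fun k : 'I_p => half_symbol (D (shift i k)) v j 0%R).
Proof.
by apply: (balanced_half_symbol_last p_prime) => k; apply: digits_shift_last.
Qed.

Lemma balanced_const_line (i : 'I_n) j :
  balanced (fun x : 'I_n => half_symbol (D i) (D x) j 0%R).
Proof.
apply: (@balanced_line 0%R 1%R (fun=> i) id); first exact: oner_neq0.
  by move=> x k; rewrite mulr0 scale0r addr0.
by move=> x k; rewrite mulr1 digits_shift_top.
Qed.

(** With v fixed, a shift of the top digit of u is invisible to this half of the
symbol, so the average is taken over shifts by 0, .., p - 1 instead. *)
Lemma balanced_line_const (i : 'I_n) j :
  balanced (fun x : 'I_n => half_symbol (D x) (D i) j 0%R).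
Proof.
apply: (balanced_average p_prime (tau := fun k x => shift x k)).
  by move=> k; apply: shift_inj.
by move=> x; apply: balanced_consecutive.
Qed.

Lemma square_row i : 2 * (\sum_j square i j) = n * (n ^ 2 - 1).
Proof.
rewrite -[X in X * (_ - _)]card_ord; apply: (sum_square (f := fun=> i)) => j.
  exact: balanced_const_line.
exact: balanced_line_const.
Qed.

Lemma square_col j : 2 * (\sum_i square i j) = n * (n ^ 2 - 1).
Proof.
rewrite -[X in X * (_ - _)]card_ord; apply: (sum_square (g := fun=> j)) => i.
  exact: balanced_line_const.
exact: balanced_const_line.
Qed.

Lemma square_diagonal i j :
  2 * (\sum_(k < n) square (shift i k) (shift j k)) = n * (n ^ 2 - 1).
Proof.
rewrite -[X in X * (_ - _)]card_ord.
by apply: sum_square => l; apply: (@balanced_line 1%R 1%R (shift _) (shift _));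
  rewrite ?oner_neq0 // => x k; rewrite mulr1 digits_shift_shift_top.
Qed.

Lemma square_off_diagonal i j :
  2 * (\sum_(k < n) square (shift i (n - k)) (shift j k)) = n * (n ^ 2 - 1).
Proof.
have shiftE (x : 'I_n) k : D (shift j (shift x (k * p ^ q.+1)))
    = (D (shift j x) + (k%:R * 1) *: e1 p q)%R.
  by rewrite mulr1 digits_shift_shift_top.
have oppE (x : 'I_n) k : D (shift i (n - shift x (k * p ^ q.+1)))
    = (D (shift i (n - x)) + (k%:R * -1) *: e1 p q)%R.
  by rewrite mulrN1 digits_opp_shift_top.
rewrite -[X in X * (_ - _)]card_ord; apply: sum_square => l.
  exact: (@balanced_line (-1)%R 1%R (fun x => shift i (n - x))).
by apply: (@balanced_line 1%R (-1)%R _ (fun x => shift i (n - x)));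
   rewrite ?oppr_eq0 ?oner_neq0.
Qed.

Lemma square_complementary : complementary p square.
Proof.
have -> : complementary p square = (forall i j : 'I_n,
    2 * (\sum_(k < p) square (shift i (k * p ^ q.+1)) (shift j (k * p ^ q.+1)))
    = p * (n ^ 2 - 1)).
  by rewrite /complementary [in p ^ _ %/ p]expnS mulKn ?prime_gt0.
move=> i j; rewrite -[X in X * (_ - _)]card_ord.
apply: sum_square => l;
  by apply: (@balanced_half_symbol_top p q p_prime _ _ _ _ 1%R 1%R) => [|k|k];
  rewrite ?oner_neq0 // mulr1 digits_shift_top.
Qed.

Lemma square_subsquare : subsquare_property p square.
Proof.
move=> i j; rewrite pair_bigA /=.
have -> : p ^ 2 = #|{: 'I_p * 'I_p}| by rewrite card_prod card_ord.
apply: (sum_square (f := fun z : 'I_p * 'I_p => shift i z.1)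
  (g := fun z : 'I_p * 'I_p => shift j z.2)) => l; last first.
  apply: balanced_fibers => k /=.
  exact: (balanced_consecutive j (D (shift i k)) l).
(* The two halves of the symbol are balanced in different directions: this one
   along columns, the other one along rows. *)
apply: (@balanced_reindex p _ _ (fun z : 'I_p * 'I_p => (z.2, z.1))).
  by exists (fun z : 'I_p * 'I_p => (z.2, z.1)); case.
apply: balanced_fibers => k /=.
exact: (balanced_consecutive i (D (shift j k)) l).
Qed.

Lemma square_natural : natural_square square.
Proof.
move=> v ltv; have {}ltv : v < p ^ (r + r) by rewrite addnn -muln2 expnM.
pose w := (matM p r *m digits p (r + r) v)%R.
have [a lta aE] := digits_surj p_prime (usubmx w).
have [b ltb bE] := digits_surj p_prime (dsubmx w).
rewrite -[RHS](cards1 (Ordinal lta, Ordinal ltb)); apply: eq_card => -[c d].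
rewrite !inE xpair_eqE /=; apply/eqP/andP => [sqE|[/eqP-> /eqP->]]; last first.
  rewrite mxE /= aE bE (symbol_matM p_prime (w := digits p (r + r) v)).
    by rewrite undigits_digits.
  by rewrite vsubmxK.
have : w = location p r c d.
  by rewrite /w -sqE mxE undigitsK // matM_symbol.
rewrite -(vsubmxK w) -aE -bE => /eq_col_mx[/(congr1 (@undigits p r)) cE].
move=> /(congr1 (@undigits p r)) dE.
move: cE dE; rewrite !undigits_digits // => cE dE.
by rewrite -!val_eqE /= cE dE.
Qed.

Lemma square_pandiagonal : pandiagonal_magic_square square.
Proof.
have halfE x : 2 * x = n * (n ^ 2 - 1) -> x = (n * (n ^ 2 - 1))./2.
  by move=> <-; rewrite mul2n doubleK.
(* The halving is exact: each line has a sum whose double is n * (n ^ 2 - 1). *)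
exists (n * (n ^ 2 - 1))./2; split=> *; apply: halfE;
  by rewrite (square_row, square_col, square_diagonal, square_off_diagonal).
Qed.

End Square.

(** The main diagonals are the broken ones through the top left and the bottom
left corner. *)
Lemma pandiagonal_magic n (R : 'M[nat]_n) :
  pandiagonal_magic_square R -> magic_square R.
Proof.
case: n R => [|n] R [s [rowE colE diagE offE]].
  exists 0; split; try by case.
    by rewrite big_ord0.
  by rewrite big_ord0.
exists s; split=> //.
  rewrite -(diagE ord0 ord0); apply: eq_bigr => k _.
  by have -> : shift ord0 k = k by apply: val_inj; rewrite /= add0n modn_small.
rewrite -(offE ord_max ord0); apply: eq_bigr => k _; have ltk := ltn_ord k.
congr (R _ _); apply: val_inj => /=; last by rewrite add0n modn_small.
have -> : n + (n.+1 - k) = n - k + n.+1 by lia.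
by rewrite subSS modnDr modn_small // ltnS leq_subr.
Qed.

Theorem theorem4p4 (p r : nat) (p_prime : prime p) (r_ge2 : 2 <= r) :
  exists R : 'M[nat]_(p ^ r),
    [/\ unique (array_of (matM p r)) R,
        linear_square R
      & most_perfect p R].
Proof.
case: r r_ge2 => [|[|q]] // _; exists (square p q).
have pandiag := square_pandiagonal q p_prime.
have array := array_of_square p_prime (q := q).
split.
- by split=> // R; apply: array_of_unique.
- by split; [apply: pandiagonal_magic | exists (matM p q.+2)].
- split=> //.
  + by rewrite expn_gt0 prime_gt0 // expnS dvdn_mulr.
  + exact: square_natural.
  + exact: square_complementary.
  + exact: square_subsquare.
Qed.
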